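(* Let $n\geq 1$ and $\alpha\in\mathbb R$. (i) If $\alpha$ is irrational, then a wave $u(x,t)$ on $\mathbb R^n$ is uniquely determined by its snapshots $u_0$, $u_1$ and $u_\alpha$. (ii) If $\alpha$ is a nonzero rational number, $\alpha=p/q$ in lowest terms (with $q>0$), then, for $t\in\mathbb R$, the snapshot $u_t$ of a wave $u$ on $\mathbb R^n$ is determined by $u_0$, $u_1$ and $u_\alpha$ if and only if $t$ is an integer multiple of $1/q$.
   Context: A wave on $\mathbb R^n$ is a function $u\in C^\infty(\mathbb R^n\times\mathbb R)$ satisfying $\Delta u=\partial^2u/\partial t^2$, where $\Delta=\sum_{j=1}^n\partial^2/\partial x_j^2$; its snapshot at time $t$ is $u_t(x)=u(x,t)$. ''Determined by $u_0,u_1,u_\alpha$'' means: any two waves having the same snapshots at the times $0,1,\alpha$ are equal (in (i)), respectively have the same snapshot at time $t$ (in (ii)). *)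

(* Defs.v *)
From mathcomp Require Import all_boot all_order all_algebra.
From mathcomp Require Import all_classical all_reals all_analysis.

Set Implicit Arguments.
Unset Strict Implicit.
Unset Printing Implicit Defensive.

Import Order.TTheory GRing.Theory Num.Theory.
Import numFieldNormedType.Exports.

Local Open Scope classical_set_scope.
Local Open Scope ring_scope.

Section Waves.
Context {R : realType} {n : nat}.

Definition spacetime := ('rV[R]_n * R)%type.

Definition space_dir (j : 'I_n) : spacetime := (delta_mx 0 j, 0).

Definition time_dir : spacetime := (0, 1).

(* [Some j] stands for the variable x_j and [None] for t. *)
Definition coord_dir (i : option 'I_n) : spacetime :=
  if i is Some j then space_dir j else time_dir.

(* The value of 'D_v f at a point where f is not derivable along v is
   unspecified, so derivability is required explicitly at each stage. *)
Fixpoint C_k (k : nat) (f : spacetime -> R) : Prop :=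
  continuous f /\
  if k is k'.+1 then
    forall i : option 'I_n,
      (forall z, derivable f z (coord_dir i)) /\ C_k k' ('D_(coord_dir i) f)
  else True.

Definition C_infty (f : spacetime -> R) : Prop := forall k, C_k k f.

Definition laplacian (u : spacetime -> R) (z : spacetime) : R :=
  \sum_(j < n) 'D_(space_dir j) ('D_(space_dir j) u) z.

Definition is_wave (u : spacetime -> R) : Prop :=
  C_infty u /\ forall z, laplacian u z = 'D_time_dir ('D_time_dir u) z.

Definition snapshot (u : spacetime -> R) (t : R) : 'rV[R]_n -> R :=
  fun x => u (x, t).

Definition same_snapshots (alpha : R) (u v : spacetime -> R) : Prop :=
  [/\ snapshot u 0 = snapshot v 0, snapshot u 1 = snapshot v 1
    & snapshot u alpha = snapshot v alpha].

End Waves.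

Arguments spacetime : clear implicits.

Definition wave_determined (R : realType) (n : nat) (alpha : R) : Prop :=
  forall u v : spacetime R n -> R,
    is_wave u -> is_wave v -> same_snapshots alpha u v -> u = v.

Definition snapshot_determined (R : realType) (n : nat) (alpha t : R) : Prop :=
  forall u v : spacetime R n -> R,
    is_wave u -> is_wave v -> same_snapshots alpha u v ->
    snapshot u t = snapshot v t.

(* Main.v *)
(* The main point is that a wave with zero Cauchy data at time 0 vanishes. It
   is proved by an energy estimate: for the weight w = max(A - M t - |x - y|^2, 0)
   and the energy e = u_t^2 + |grad u|^2, the field (w^2 e, - 2 w^2 u_t grad u)
   vanishes on the boundary of a cube and, for M large, has divergence at most
   - 2 w e, so that w e = 0. The divergence theorem is used without integrals:
   for a field vanishing on the faces of a cube, the difference quotients over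
   a uniform grid sum to zero, and they are uniformly close to the divergence.

   Consequently a wave vanishing at time b is odd about b, and a wave vanishing
   at the times 0, 1 and alpha has time periods 2 and 2 alpha. If alpha is
   irrational these generate a dense group; if alpha = p/q they generate
   (2/q)Z, and one of p and q is odd, so the wave vanishes on (1/q)Z.
   Conversely sin(q pi t) cos(q pi x_1) vanishes at no other time. *)
Require Import Defs.
From mathcomp Require Import all_boot all_order all_algebra.
From mathcomp Require Import all_classical all_reals all_analysis.
From mathcomp Require Import ring lra zify.

Import Order.TTheory GRing.Theory Num.Theory.
Import numFieldNormedType.Exports.

Local Open Scope classical_set_scope.
Local Open Scope ring_scope.

Set Implicit Arguments.
Unset Strict Implicit.
Unset Printing Implicit Defensive.

(** * Directional derivatives as derivatives along lines *)

Section DirectionalDerivatives.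
Context {R : realType} {V : normedModType R}.
Implicit Types (f g : V -> R) (v w z : V).

Lemma is_derive_line f v z (t : R) l :
  is_derive (t *: v + z) v f l -> is_derive t 1 (fun s => f (s *: v + z)) l.
Proof.
have E : (fun h : R => h^-1 *: (((fun s => f (s *: v + z)) \o shift t) (h *: 1)
            - f (t *: v + z))) =
         (fun h : R => h^-1 *: ((f \o shift (t *: v + z)) (h *: v)
            - f (t *: v + z))).
  by apply/funext => h /=; rewrite [h%:A]mulr1 scalerDl addrA.
by case=> df dv; split; [rewrite /derivable E|rewrite /derive E].
Qed.

Lemma is_derive_line0 f v z l :
  is_derive (0 : R) 1 (fun s => f (s *: v + z)) l -> is_derive z v f l.
Proof.
have E : (fun h : R => h^-1 *: (((fun s => f (s *: v + z)) \o shift 0) (h *: 1)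
            - f (0 *: v + z))) =
         (fun h : R => h^-1 *: ((f \o shift z) (h *: v) - f z)).
  by apply/funext => h /=; rewrite [h%:A]mulr1 addr0 scale0r add0r.
case=> df dv; split.
  by move: df; rewrite /derivable E.
by rewrite -dv /derive E.
Qed.

Lemma is_derive_comp1 f (g : R -> R) z v df dg :
  is_derive z v f df -> is_derive (f z) 1 g dg ->
  is_derive z v (fun z => g (f z)) (dg * df).
Proof.
move=> hf hg; apply: is_derive_line0.
have hf0 : is_derive (0 : R) 1 (fun s => f (s *: v + z)) df.
  by apply: is_derive_line; rewrite scale0r add0r.
apply: (@is_derive1_comp _ g (fun s => f (s *: v + z))) hf0.
by rewrite scale0r add0r.
Qed.

Lemma is_derive_scale_dir f z v (c l : R) :
  is_derive z v f l -> is_derive z (c *: v) f (c * l).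
Proof.
move=> hf; apply: is_derive_line0.
rewrite (_ : (fun s => _) = (fun s => f (s *: v + z)) \o (fun s => c * s)); last first.
  by apply/funext => s /=; rewrite scalerA mulrC.
rewrite mulrC; apply: is_derive1_comp.
  by rewrite mulr0; apply: is_derive_line; rewrite scale0r add0r.
by have := is_deriveZ c (is_derive_id (0 : R) (1 : R)); rewrite [c *: 1]mulr1.
Qed.

End DirectionalDerivatives.

(** * Mean value theorem along lines and symmetry of mixed derivatives *)

Section MeanValue.
Context {R : realType} {V : normedModType R}.
Implicit Types (f : V -> R) (v w z : V).

(** A chain rule free of total differentiability: since [g] maps the line along [v] affinely onto a
    line along [w], derivability of [f] in that one direction is enough. *)
Lemma is_derive_comp_affine (W : normedModType R) (f : W -> R) (g : V -> W)
    z v (w : W) l :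
  (forall h : R, g (h *: v + z) = h *: w + g z) ->
  is_derive (g z) w f l -> is_derive z v (f \o g) l.
Proof.
move=> hg hf; apply: is_derive_line0.
rewrite (_ : (fun s => _) = fun s => f (s *: w + g z)); last first.
  by apply/funext => s /=; rewrite hg.
by apply: is_derive_line; rewrite scale0r add0r.
Qed.

Lemma MVT_line f v z (s : R) : 0 <= s -> (forall z, derivable f z v) ->
  exists2 x, 0 <= x <= s & f (s *: v + z) - f z = 'D_v f (x *: v + z) * s.
Proof.
move=> s0 df.
have D (x : R) : is_derive x 1 (fun s : R => f (s *: v + z)) ('D_v f (x *: v + z)).
  by apply: is_derive_line; exact: derivableP.
have [|x xs] := @MVT_segment R (fun s : R => f (s *: v + z))
    (fun x => 'D_v f (x *: v + z)) 0 s s0 (fun x _ => D x).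
  apply/continuous_subspaceT => y.
  by apply/differentiable_continuous/derivable1_diffP; case: (D y).
rewrite scale0r add0r subr0 => e; exists x => //.
Qed.

(* Both mixed derivatives are limits of the same second difference quotient. *)
Lemma derive_swap f v w z :
  (forall z, derivable f z v) -> (forall z, derivable f z w) ->
  (forall z, derivable ('D_v f) z w) -> (forall z, derivable ('D_w f) z v) ->
  continuous ('D_w ('D_v f)) -> continuous ('D_v ('D_w f)) ->
  'D_w ('D_v f) z = 'D_v ('D_w f) z.
Proof.
move=> fv fw fvw fwv cvw cwv.
(* The mean value theorem is applied twice: along [a] to the increment of [f] by [h *: b], then
   along [b] to ['D_a f]. *)
have second_diff a b (h : R) : 0 < h -> (forall z, derivable f z a) ->
    (forall z, derivable ('D_a f) z b) ->
    exists x, exists2 y, (0 <= x <= h) && (0 <= y <= h) &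
    f (h *: a + (h *: b + z)) - f (h *: b + z) - f (h *: a + z) + f z =
    'D_b ('D_a f) (x *: a + (y *: b + z)) * h ^+ 2.
  move=> h0 fa fab; pose g z := f (h *: b + z) - f z.
  have dg u : is_derive u a g ('D_a f (h *: b + u) - 'D_a f u).
    apply: is_deriveB; last exact: derivableP.
    apply: (@is_derive_comp_affine _ f (fun z => h *: b + z) _ _ a).
      by move=> k; rewrite addrCA.
    exact: derivableP.
  have [x xh ex] := @MVT_line g a z h (ltW h0) (fun u => ex_derive (is_derive := dg u)).
  have [y yh ey] := @MVT_line ('D_a f) b (x *: a + z) h (ltW h0) fab.
  exists x, y; first by rewrite xh.
  move: ex; rewrite (derive_val (is_derive := dg _)) /g ey => ex.
  rewrite expr2 mulrA (addrCA (x *: a)) -ex (addrCA (h *: b)).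
  ring.
have close (F : V -> R) (a b : V) (e : R) : continuous F -> 0 < e ->
    exists2 d : R, 0 < d & forall x y, 0 <= x <= d -> 0 <= y <= d ->
    `|F (x *: a + (y *: b + z)) - F z| < e.
  move=> cF e0; have /cvgrPdist_lt /(_ e e0) := cF z.
  rewrite -filter_from_ballE => -[d /= d0 hd].
  (* As [K] exceeds the sum of the two norms, coefficients in [0, d / (2 K)] move [z] by less than
     [d]. *)
  pose K := `|a| + `|b| + 1.
  have K0 : 0 < K by rewrite ltr_wpDl // addr_ge0.
  pose q := d / (2 * K); have q0 : 0 < q by rewrite divr_gt0 // mulr_gt0.
  have dq : d = q * (2 * K) by rewrite divfK // gt_eqF // mulr_gt0.
  exists q => // x y /andP[x0 xq] /andP[y0 yq]; rewrite distrC; apply: hd.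
  rewrite -ball_normE /ball_ /= addrA opprD addrCA subrr addr0 normrN.
  rewrite (le_lt_trans (ler_normD _ _)) // !normrZ !ger0_norm // dq /K.
  have := ler_wpM2r (normr_ge0 a) xq; have := ler_wpM2r (normr_ge0 b) yq.
  have := mulr_ge0 (ltW q0) (normr_ge0 a).
  have := mulr_ge0 (ltW q0) (normr_ge0 b).
  set A := `|a|; set B := `|b|; move: A B => A B; clear -q0; move: q q0 => q q0.
  move=> *; nra.
apply/eqP; rewrite -subr_eq0 -normr_eq0 eq_le normr_ge0 andbT.
apply/ler_addgt0Pr => e e0; rewrite add0r.
have e2 : 0 < e / 2 by rewrite divr_gt0.
have [d1 d10 h1] := close _ v w _ cvw e2.
have [d2 d20 h2] := close _ w v _ cwv e2.
pose h := Num.min d1 d2; have h0 : 0 < h by rewrite lt_min d10.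
have [x1 [y1 /andP[/andP[x10 x1h] /andP[y10 y1h]] e1]] := second_diff v w h h0 fv fvw.
have [x2 [y2 /andP[/andP[x20 x2h] /andP[y20 y2h]] E2]] := second_diff w v h h0 fw fwv.
have le1 x : x <= h -> x <= d1 by move/le_trans; apply; rewrite ge_min lexx.
have le2 x : x <= h -> x <= d2 by move/le_trans; apply; rewrite ge_min lexx orbT.
have c1 := h1 x1 y1 (introT andP (conj x10 (le1 _ x1h))) (introT andP (conj y10 (le1 _ y1h))).
have := h2 x2 y2 (introT andP (conj x20 (le2 _ x2h))) (introT andP (conj y20 (le2 _ y2h))).
(* The second difference is symmetric in [v] and [w], so the two intermediate values agree after
   division by h^2. *)
have -> : 'D_v ('D_w f) (x2 *: w + (y2 *: v + z)) =
          'D_w ('D_v f) (x1 *: v + (y1 *: w + z)).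
  apply: (mulIf (x := h ^+ 2)); first by rewrite expf_neq0 // gt_eqF.
  apply: etrans (esym E2) _; apply: etrans _ e1.
  by rewrite addrCA; congr (_ + _); rewrite addrAC.
move=> c2; rewrite (splitr e); apply: le_trans (ler_distD _ _ _) _.
by apply: lerD; apply: ltW; [rewrite distrC; exact: c1|exact: c2].
Qed.

End MeanValue.

(** * A divergence theorem by sums over uniform grids *)

Section Divergence.
Context {R : realType}.

(** Uniform continuity near a compact set: [y] may leave [K], which saves checking that intermediate
    points stay in the cube. Each center is given half of its radius of continuity, so that a
    neighbor of a nearby point remains in the full ball. *)
Lemma compact_unif_continuous (V : normedModType R) (K : set V) (f : V -> R) (e : R) :
  compact K -> continuous f -> 0 < e ->
  \forall d \near (0 : R)^'+, forall x y, K x -> `|y - x| <= d -> `|f y - f x| < e.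
Proof.
move=> /compact_near_coveringP cK cf e0.
suff : \forall d \near (0 : R)^'+,
    K `<=` (fun x => forall y, `|y - x| <= d -> `|f y - f x| < e).
  by apply: filterS => d hd x y Kx; exact: hd.
apply: cK => x Kx; have e2 : 0 < e / 2 by rewrite divr_gt0.
have /cvgrPdist_lt /(_ _ e2) := cf x.
rewrite -filter_from_ballE => -[d /= d0 hd].
have d2 : 0 < d / 2 by rewrite divr_gt0.
exists (ball x (d / 2), [set r | r < d / 2]) => /=.
  by split; [exact: nbhsx_ballx|exact: nbhs_right_lt].
case=> x' r [/= xx' rd] y yx'.
have xy : ball x d y.
  rewrite -ball_normE /ball_ /= (splitr d).
  rewrite (le_lt_trans (ler_distD x' _ _)) // ltr_leD //.
    by rewrite -ball_normE in xx'.
  by rewrite distrC (le_trans yx') // ltW.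
have xx : ball x d x'.
  rewrite -ball_normE /ball_ /= in xx' *.
  by rewrite (lt_le_trans xx') // ler_pdivrMr // mulr_natr mulr2n lerDl ltW.
rewrite (splitr e) (le_lt_trans (ler_distD (f x) _ _)) // ltrD //.
  by rewrite distrC; exact: hd xy.
exact: hd xx.
Qed.

Context {n : nat}.
Notation spacetime := (spacetime R n).
Implicit Types (z : spacetime) (i : option 'I_n).

Definition stcoord z i : R := if i is Some j then z.1 0 j else z.2.

Definition of_coord (s : option 'I_n -> R) : spacetime :=
  (\row_j s (Some j), s None).

Lemma of_coordK s i : stcoord (of_coord s) i = s i.
Proof. by case: i => [j|] //=; rewrite mxE. Qed.

Lemma coordP z z' : stcoord z =1 stcoord z' -> z = z'.
Proof.
case: z z' => [x t] [x' t'] e; congr pair; last exact: (e None).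
by apply/rowP => j; exact: (e (Some j)).
Qed.

Lemma coord_lin (h : R) z z' i : stcoord (h *: z + z') i = h * stcoord z i + stcoord z' i.
Proof. by case: i => [j|] //=; rewrite !mxE. Qed.

Lemma coordB z z' i : stcoord (z - z') i = stcoord z i - stcoord z' i.
Proof. by case: i => [j|] //=; rewrite !mxE. Qed.

Lemma coord_coord_dir i i' : stcoord (coord_dir i) i' = (i == i')%:R.
Proof.
by case: i i' => [j|] [j'|] //=; rewrite !mxE // eqxx eq_sym.
Qed.

Lemma norm_le_coord z (e : R) : 0 <= e -> (forall i, `|stcoord z i| <= e) -> `|z| <= e.
Proof.
move=> e0 h; rewrite prod_normE ge_max (h None) andbT.
rewrite [leLHS]mx_normrE; apply/bigmax_leP; split=> // -[k j] _ /=.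
by rewrite ord1; exact: (h (Some j)).
Qed.

Lemma norm_coord_dir i : `|coord_dir i : spacetime| <= 1.
Proof.
apply: norm_le_coord => // i'; rewrite coord_coord_dir normr_nat.
by case: (i == i').
Qed.

Lemma continuous_coord i : continuous (stcoord ^~ i).
Proof.
move=> z; case: i => [j|] /=; last exact: cvg_snd.
apply: (@continuous_comp _ _ _ fst (fun v : 'rV[R]_n => v 0 j)); first exact: cvg_fst.
exact: coord_continuous.
Qed.

Definition cube (a : option 'I_n -> R) (S : R) : set spacetime :=
  [set z | forall i, a i <= stcoord z i <= a i + S].

Lemma compact_cube a S : compact (cube a S).
Proof.
rewrite (_ : cube a S =
  [set v : 'rV[R]_n | forall j, `[a (Some j), a (Some j) + S]%classic (v ord0 j)]
  `*` `[a None, a None + S]%classic); last first.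
  apply/seteqP; split => -[x t] /= h.
    by split => [j|]; rewrite in_itv /=; [exact: (h (Some j))|exact: (h None)].
  move: h => [h1 h2] [j|] /=; last by move: h2; rewrite in_itv.
  by move: (h1 j); rewrite /= in_itv.
apply: compact_setX; last exact: segment_compact.
by apply: (@rV_compact R n (fun j => `[a (Some j), a (Some j) + S]%classic)) => j;
  exact: segment_compact.
Qed.

Definition grid (a : option 'I_n -> R) (h : R) N (k : {ffun option 'I_n -> 'I_N}) :=
  of_coord (fun i => a i + (k i)%:R * h).

(** [ordS] sends the last index back to 0, so this is a permutation of the grid and reindexing by it
    preserves sums. *)
Definition cyclic_shift N i (k : {ffun option 'I_n -> 'I_N}) :=
  [ffun i' => if i' == i then ordS (k i') else k i'].

Lemma cyclic_shift_inj N i : injective (@cyclic_shift N i).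
Proof.
move=> k k' /ffunP e; apply/ffunP => i'; have := e i'; rewrite !ffunE.
by case: ifP => // _ /ordS_inj.
Qed.

Lemma grid_cube a S N (k : {ffun option 'I_n -> 'I_N}) : (0 < N)%N -> 0 < S ->
  cube a S (grid a (S / N%:R) k).
Proof.
move=> N0 S0 i; rewrite of_coordK.
have NR : 0 < N%:R :> R by rewrite ltr0n.
rewrite lerDl mulr_ge0 ?divr_ge0 // ?(ltW S0) // ?(ltW NR) //= lerD2l.
rewrite mulrCA ger_pMr // ler_pdivrMr // mul1r ler_nat.
exact: ltnW.
Qed.

(* A field that vanishes on the faces of a cube has, on average over a fine
   grid, almost zero divergence: the difference quotients sum to zero by
   cyclic shift, since both faces contribute zero. *)
Lemma grid_sum_derive (a : option 'I_n -> R) (S : R) N i (F D : spacetime -> R) (e : R) :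
  0 < S -> (0 < N)%N ->
  (forall z, is_derive z (coord_dir i) F (D z)) ->
  (forall z, cube a S z -> stcoord z i = a i \/ stcoord z i = a i + S -> F z = 0) ->
  (forall z z', cube a S z -> `|z' - z| <= S / N%:R -> `|D z' - D z| < e) ->
  `|\sum_k D (grid a (S / N%:R) (N := N) k)| <= #|{ffun option 'I_n -> 'I_N}|%:R * e.
Proof.
move=> S0 N0 dF faces unif; set h := S / N%:R.
have NR : 0 < N%:R :> R by rewrite ltr0n.
have h0 : 0 < h by rewrite divr_gt0.
have hN : N%:R * h = S by rewrite mulrC divfK // gt_eqF.
(* Below the last index the shift is a step of length [h]. At the last index it wraps to the lower
   face while the step reaches the upper face, and [F] vanishes on both. *)
have shiftE (k : {ffun option 'I_n -> 'I_N}) :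
      F (grid a h (cyclic_shift i k)) = F (h *: coord_dir i + grid a h k).
  have coordE i' : stcoord (h *: coord_dir i + grid a h k) i' =
      if i' == i then a i + (k i).+1%:R * h else stcoord (grid a h k) i'.
    rewrite coord_lin coord_coord_dir of_coordK (eq_sym i).
    by case: eqP => [->|_] /=; rewrite ?mulr0 ?add0r ?mulr1 // -natr1 mulrDl mul1r addrC addrA.
  have [lt|ge] := ltnP (k i).+1 N.
    congr F; apply: coordP => i'; rewrite coordE !of_coordK !ffunE.
    by case: eqP => // ->; rewrite /= modn_small.
  have kN : (k i).+1 = N by apply/eqP; rewrite eqn_leq ge ltn_ord.
  rewrite !faces //.
  - move=> i'; rewrite coordE; case: eqP => [->|_]; last exact: grid_cube.
    by rewrite kN hN lexx lerDl ltW.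
  - by right; rewrite coordE eqxx kN hN.
  - exact: grid_cube.
  - by left; rewrite of_coordK ffunE eqxx /= kN modnn mul0r addr0.
have diff0 : \sum_k (F (h *: coord_dir i + grid a h k) - F (grid a h (N := N) k)) = 0.
  rewrite sumrB [X in _ - X](reindex_inj (@cyclic_shift_inj N i)) /= -sumrB.
  by rewrite big1 // => k _; rewrite shiftE subrr.
(* The increment over a cell is [h] times the derivative at an intermediate point, at distance at
   most [h] from the grid point. *)
have bound (k : {ffun option 'I_n -> 'I_N}) :
    `|h * D (grid a h k) - (F (h *: coord_dir i + grid a h k) - F (grid a h k))|
    <= h * e.
  have [|x /andP[x0 xh] ->] := @MVT_line _ _ F (coord_dir i) (grid a h k) h (ltW h0).
    by move=> z; case: (dF z).
  rewrite (derive_val (is_derive := dF _)) mulrC -mulrBl mulrC normrM gtr0_norm //.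
  rewrite ler_pM2l // distrC ltW // unif //; first exact: grid_cube.
  rewrite addrK normrZ ger0_norm // (le_trans _ xh) //.
  by rewrite ler_piMr // norm_coord_dir.
have : `|\sum_k (h * D (grid a h (N := N) k) -
    (F (h *: coord_dir i + grid a h k) - F (grid a h k)))|
    <= \sum_(k : {ffun option 'I_n -> 'I_N}) h * e.
  by rewrite (le_trans (ler_norm_sum _ _ _)) // ler_sum // => k _; exact: bound.
rewrite sumrB diff0 subr0 -mulr_sumr normrM gtr0_norm // sumr_const -[_ *+ _]mulr_natl.
by rewrite mulrCA ler_pM2l.
Qed.

(** If [psi] were positive at [z0], it would exceed some c > 0 on a whole coarse cell around [z0].
    That cell holds a fixed fraction of the points of every finer grid, whereas the average of the
    divergence over the grid tends to 0. *)
Lemma divergence_ge0_eq0 (a : option 'I_n -> R) (S : R) (F D : option 'I_n -> spacetime -> R)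
    (psi : spacetime -> R) :
  0 < S ->
  (forall i z, is_derive z (coord_dir i) (F i) (D i z)) ->
  (forall i, continuous (D i)) -> continuous psi ->
  (forall i z, cube a S z -> stcoord z i = a i \/ stcoord z i = a i + S -> F i z = 0) ->
  (forall z, cube a S z -> 0 <= psi z <= - \sum_i D i z) ->
  forall z, cube a S z -> (forall i, stcoord z i < a i + S) -> psi z = 0.
Proof.
move=> S0 dF cD cpsi faces psiD z0 Kz0 z0lt; apply/eqP.
rewrite eq_le; have /andP[-> _] := psiD z0 Kz0; rewrite andbT leNgt.
apply/negP => psi0; pose c := psi z0 / 2.
have c0 : 0 < c by rewrite divr_gt0.
have [d1 /= d10 unif1] : exists2 d1 : R, 0 < d1 &
    forall y, `|y - z0| <= d1 -> c <= psi y.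
  have [d1 [d10 h1]] := @filter_ex _ (0 : R)^'+ _ _
    (filterI (nbhs_right_gt 0) (compact_unif_continuous (@compact_cube a S) cpsi c0)).
  exists d1 => // y yz; have := h1 z0 y Kz0 yz.
  by rewrite ltr_norml /c => /andP[]; lra.
have large (d : R) : 0 < d -> exists2 m, (0 < m)%N & S / m%:R <= d.
  move=> d0; exists (Num.truncn (S / d)).+1 => //.
  rewrite ler_pdivrMr ?ltr0n // mulrC -ler_pdivrMr //.
  by rewrite ltW // truncnS_gt.
have [Q Q0 Qd1] := large d1 d10.
have QR : 0 < Q%:R :> R by rewrite ltr0n.
(* Here [d] is the dimension of spacetime. The choice of [e] gives d Q^d e < c, the inequality that
   contradicts the final count; the added 1 makes it strict. *)
pose d := #|{: option 'I_n}|; pose e := c / (d * Q ^ d + 1)%:R.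
have e0 : 0 < e by rewrite divr_gt0 // ltr0n addn1.
have [d2 d20 unif2] : exists2 d2 : R, 0 < d2 &
    forall i z z', cube a S z -> `|z' - z| <= d2 -> `|D i z' - D i z| < e.
  have [d2 [d20 h2]] := @filter_ex _ (0 : R)^'+ _ _
    (filterI (nbhs_right_gt 0) (filter_forall _ (fun i =>
      compact_unif_continuous (@compact_cube a S) (cD i) e0))).
  by exists d2 => // i; exact: h2.
have [m m0 md2] := large d2 d20.
have QmR : 0 < m%:R :> R by rewrite ltr0n.
(* Taking a multiple of [Q] makes the fine grid subdivide each coarse cell into m^d cells. *)
pose N := (Q * m)%N; have N0 : (0 < N)%N by rewrite muln_gt0 Q0.
pose h := S / N%:R; have h0 : 0 < h by rewrite divr_gt0 // ltr0n.
have hd2 : h <= d2.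
  rewrite (le_trans _ md2) // ler_pM2l // lef_pV2 ?posrE ?ltr0n //.
  by rewrite ler_nat leq_pmull.
(* The coarse cell containing [z0] is found by truncation; the strict bound [z0lt] keeps its index
   below [Q]. *)
have q_ex i : {q : 'I_Q | a i + q%:R * (S / Q%:R) <= stcoord z0 i
                          <= a i + q.+1%:R * (S / Q%:R)}.
  have SQ : 0 < S / Q%:R by rewrite divr_gt0.
  have /andP[ai _] := Kz0 i; pose x := (stcoord z0 i - a i) / (S / Q%:R).
  have x0 : 0 <= x by rewrite divr_ge0 ?subr_ge0 // ltW.
  have xQ : (Num.truncn x < Q)%N.
    rewrite -(ltr_nat R); apply: (@le_lt_trans _ _ x); first by rewrite truncn_le.
    rewrite ltr_pdivrMr // mulrCA divff ?gt_eqF // mulr1.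
    by rewrite ltrBlDl z0lt.
  have xE : stcoord z0 i = a i + x * (S / Q%:R) by rewrite divfK ?gt_eqF // addrC subrK.
  exists (Ordinal xQ); rewrite /= xE !lerD2l !ler_pM2r //.
  by rewrite truncn_le x0 ltW // truncnS_gt.
pose q i := sval (q_ex i).
have iota_lt i (r : 'I_m) : (q i * m + r < N)%N.
  by rewrite /N (@leq_trans (q i * m + m)) ?ltn_add2l // -mulSnr leq_pmul2r.
pose iota (r : {ffun option 'I_n -> 'I_m}) : {ffun option 'I_n -> 'I_N} :=
  [ffun i => Ordinal (iota_lt i (r i))].
have iota_inj : injective iota.
  move=> r r' /ffunP er; apply/ffunP => i; have := er i; rewrite !ffunE.
  by move=> [/addnI/val_inj].
have psi_iota r : c <= psi (grid a h (iota r)).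
  apply: unif1; apply: (le_trans _ Qd1); apply: norm_le_coord.
    by rewrite divr_ge0 // ltW.
  move=> i; rewrite coordB of_coordK ffunE /=.
  have /andP[q1 q2] := svalP (q_ex i); rewrite -/(q i) in q1 q2.
  have SQE : S / Q%:R = m%:R * h.
    by rewrite /h /N natrM; field; rewrite !gt_eqF.
  have r0 : 0 <= (r i)%:R * h by rewrite mulr_ge0 // ltW.
  have rm : (r i)%:R * h <= m%:R * h by rewrite ler_pM2r // ler_nat ltnW.
  move: q1 q2; rewrite SQE natrD natrM -natr1 !mulrDl mul1r -!mulrA => q1 q2.
  rewrite ler_norml; apply/andP; split; lra.
(* Grid points in the coarse cell contribute at least [c] each, and all others at least 0. *)
have lower : (m ^ d)%:R * c <= \sum_k psi (grid a h (N := N) k).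
  have -> : (m ^ d)%N = #|(iota @: [set: {ffun option 'I_n -> 'I_m}])%SET|.
    by rewrite card_imset // cardsT card_ffun card_ord.
  rewrite mulr_natl -sumr_const big_mkcond /=; apply: ler_sum => k _.
  case: ifP => [/imsetP[r _ ->]|_]; first exact: psi_iota.
  by have /andP[] := psiD _ (grid_cube a k N0 S0).
(* Each of the [d] partial derivatives has grid sum at most N^d e in absolute value. *)
have upper : \sum_k psi (grid a h (N := N) k) <= d%:R * ((N ^ d)%:R * e).
  apply: (@le_trans _ _ (\sum_k - \sum_i D i (grid a h (N := N) k))).
    by apply: ler_sum => k _; have /andP[] := psiD _ (grid_cube a k N0 S0).
  rewrite sumrN exchange_big /= (le_trans (ler_norm _)) // normrN.
  rewrite (le_trans (ler_norm_sum _ _ _)) //.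
  have -> : d%:R * ((N ^ d)%:R * e) = \sum_(i : option 'I_n) (N ^ d)%:R * e.
    by rewrite sumr_const mulr_natl.
  apply: ler_sum => i _.
  have -> : (N ^ d)%N = #|{ffun option 'I_n -> 'I_N}| by rewrite card_ffun card_ord.
  apply: (@grid_sum_derive a S N i (F i)) => //; first exact: faces.
  by move=> z z' Kz zz'; apply: unif2 => //; exact: le_trans zz' hd2.
have := le_trans lower upper; rewrite leNgt => /negP; apply.
rewrite /N expnMn natrM.
have -> : d%:R * ((Q ^ d)%:R * (m ^ d)%:R * e) = (m ^ d)%:R * ((d * Q ^ d)%:R * e) :> R.
  by rewrite natrM; ring.
rewrite ltr_pM2l ?ltr0n ?expn_gt0 ?m0 //.
rewrite /e mulrCA gtr_pMr // ltr_pdivrMr ?ltr0n ?addn1 // mul1r ltr_nat.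
exact: ltnSn.
Qed.

End Divergence.

(** * Calculus rules in pointwise form *)

Section Pointwise.
Context {R : realType} {V : normedModType R}.
Implicit Types (f g : V -> R) (z v : V).

Lemma is_derive_mul f g z v df dg : is_derive z v f df -> is_derive z v g dg ->
  is_derive z v (fun z => f z * g z) (df * g z + f z * dg).
Proof.
by move=> hf hg; have := is_deriveM hf hg; rewrite addrC [g z *: _]mulrC.
Qed.

Lemma is_derive_scale (c : R) f z v df :
  is_derive z v f df -> is_derive z v (fun z => c * f z) (c * df).
Proof. by move=> hf; exact: is_deriveZ. Qed.

Lemma is_derive_sqr f z v df :
  is_derive z v f df -> is_derive z v (fun z => f z ^+ 2) (2 * f z * df).
Proof.
by move=> hf; have := is_derive_mul hf hf => h; apply: is_derive_eq h _; ring.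
Qed.

Lemma is_derive_bigsum m (f : 'I_m -> V -> R) z v (df : 'I_m -> R) :
  (forall j, is_derive z v (f j) (df j)) ->
  is_derive z v (fun z => \sum_j f j z) (\sum_j df j).
Proof. by move=> hf; have := is_derive_sum hf; rewrite fct_sumE. Qed.

Lemma continuous_add f g : continuous f -> continuous g ->
  continuous (fun z => f z + g z).
Proof. by move=> cf cg z; apply: cvgD; [exact: cf|exact: cg]. Qed.

Lemma continuous_mul f g : continuous f -> continuous g ->
  continuous (fun z => f z * g z).
Proof. by move=> cf cg z; apply: cvgM; [exact: cf|exact: cg]. Qed.

Lemma continuous_bigsum m (f : 'I_m -> V -> R) : (forall j, continuous (f j)) ->
  continuous (fun z => \sum_j f j z).
Proof.
move=> cf; rewrite -fct_sumE; elim/big_ind: _ => [z|g h cg ch z|j _].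
- exact: cvg_cst.
- by apply: cvgD; [exact: cg|exact: ch].
- exact: cf.
Qed.

End Pointwise.

(** * The squared positive part *)

Section PositivePart.
Context {R : realType}.

Lemma is_derive_quadratic_remainder (f : R -> R) (s l : R) :
  (forall h, `|f (h + s) - f s - l * h| <= h ^+ 2) -> is_derive s 1 f l.
Proof.
move=> hf.
have L : (fun h : R => h^-1 *: ((f \o shift s) (h *: 1) - f s)) @ 0^' --> l.
  apply/cvgrPdist_le => e e0; near=> h.
  have h0 : h != 0 by near: h; exact: nbhs_dnbhs_neq.
  have he : `|h| <= e.
    by near: h; apply: dnbhs0_le.
  rewrite /= [h%:A]mulr1 distrC (le_trans _ he) // -(ler_pM2l (x := `|h|)) ?normr_gt0 //.
  rewrite -!normrM mulrBr -[h^-1 *: _]/(h^-1 * _) mulrA divff // mul1r.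
  by rewrite -expr2 (ger0_norm (sqr_ge0 h)) (mulrC h).
by split; [exact: cvgP L|exact: cvg_lim L].
Unshelve. all: by end_near. Qed.

Definition pos_part (s : R) := Num.max s 0.

(** Squaring removes the kink at 0: in each of the four sign cases the first-order remainder is at
    most h^2. *)
Lemma is_derive_pos_part_sqr (s : R) :
  is_derive s 1 (fun s => pos_part s ^+ 2) (2 * pos_part s).
Proof.
apply: is_derive_quadratic_remainder => h; rewrite /pos_part !maxEle.
rewrite ler_norml; apply/andP.
case: (lerP (h + s) 0) => a; case: (lerP s 0) => b; rewrite !expr2.
- by have := sqr_ge0 h; rewrite expr2; split; lra.
- have := sqr_ge0 (h + s); have := mulr_ge0 (ltW b) (_ : 0 <= - (h + s)).
  by rewrite oppr_ge0 !expr2 => /(_ a); have := sqr_ge0 h; rewrite expr2; split; nra.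
- have := sqr_ge0 (h + s); have h0 : 0 <= h by lra.
  have := mulr_ge0 h0 (_ : 0 <= - s); rewrite oppr_ge0 !expr2 => /(_ b).
  have := mulr_ge0 (_ : 0 <= - s) (ltW a); rewrite oppr_ge0 => /(_ b).
  by have := sqr_ge0 h; rewrite expr2; split; nra.
- by have := sqr_ge0 h; rewrite expr2; split; lra.
Qed.

Lemma continuous_pos_part : continuous pos_part.
Proof. by move=> s; apply: (@continuous_max _ _ id (fun=> 0)) => //; exact: cvg_cst. Qed.

End PositivePart.

Lemma big_option (T : Type) (idx : T) (op : Monoid.com_law idx) (I : finType)
    (F : option I -> T) :
  \big[op/idx]_i F i = op (F None) (\big[op/idx]_i F (Some i)).
Proof.
rewrite (bigD1 None) //=; congr (op _ _).
rewrite (reindex_omap Some id) /= => [|[]] //.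
by apply: eq_bigl => i; rewrite eqxx.
Qed.

(** * Second derivatives, the paraboloid and the energy density *)

Section Energy.
Context {R : realType} {n : nat}.
Notation spacetime := (spacetime R n).
Implicit Types (z : spacetime) (i : option 'I_n) (u : spacetime -> R).

Lemma C2_deriv u i z : C_k 2 u -> is_derive z (coord_dir i) u ('D_(coord_dir i) u z).
Proof. by case=> _ /(_ i) [h _]; exact: derivableP. Qed.

Lemma C2_deriv2 u i i' z : C_k 2 u ->
  is_derive z (coord_dir i') ('D_(coord_dir i) u) ('D_(coord_dir i') ('D_(coord_dir i) u) z).
Proof. by case=> _ /(_ i) [_ [_ /(_ i') [h _]]]; exact: derivableP. Qed.

Lemma C2_continuous1 u i : C_k 2 u -> continuous ('D_(coord_dir i) u).
Proof. by case=> _ /(_ i) [_ []]. Qed.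

Lemma C2_continuous2 u i i' : C_k 2 u ->
  continuous ('D_(coord_dir i') ('D_(coord_dir i) u)).
Proof. by case=> _ /(_ i) [_ [_ /(_ i') [_ []]]]. Qed.

Lemma C2_swap u i i' z : C_k 2 u ->
  'D_(coord_dir i') ('D_(coord_dir i) u) z = 'D_(coord_dir i) ('D_(coord_dir i') u) z.
Proof.
move=> Cu; apply: derive_swap => [{}z|{}z|{}z|{}z||].
- by case: (C2_deriv i z Cu).
- by case: (C2_deriv i' z Cu).
- by case: (C2_deriv2 i i' z Cu).
- by case: (C2_deriv2 i' i z Cu).
- exact: C2_continuous2.
- exact: C2_continuous2.
Qed.

Lemma is_derive_coord i i' z :
  is_derive z (coord_dir i) (stcoord ^~ i') (i == i')%:R.
Proof.
apply: (@is_derive_comp_affine _ _ R id (stcoord ^~ i') z (coord_dir i) (i == i')%:R).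
by move=> h; rewrite coord_lin coord_coord_dir.
Qed.

(* The energy will be weighted by the squared positive part of this function.
   Its level sets are paraboloids rather than light cones: any finite bound on
   the propagation speed suffices, as [A] can be taken arbitrarily large. *)
Definition paraboloid (A M : R) (y : 'rV[R]_n) z : R :=
  A - M * stcoord z None - \sum_j (stcoord z (Some j) - y 0 j) ^+ 2.

Definition dparaboloid (M : R) (y : 'rV[R]_n) i z : R :=
  if i is Some j then - (2 * (stcoord z (Some j) - y 0 j)) else - M.

Lemma is_derive_paraboloid A M y i z :
  is_derive z (coord_dir i) (paraboloid A M y) (dparaboloid M y i z).
Proof.
have d1 : is_derive z (coord_dir i) (fun z => A - M * stcoord z None)
    (0 - M * (i == None)%:R).
  by apply: is_deriveB; apply: is_derive_scale; exact: is_derive_coord.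
have d2 : is_derive z (coord_dir i)
    (fun z => \sum_j (stcoord z (Some j) - y 0 j) ^+ 2)
    (\sum_j 2 * (stcoord z (Some j) - y 0 j) * ((i == Some j)%:R - 0)).
  apply: is_derive_bigsum => j; apply: is_derive_sqr.
  by apply: is_deriveB; exact: is_derive_coord.
have := is_deriveB d1 d2 => /is_derive_eq; apply; case: i {d1 d2} => [j|] /=.
  rewrite mulr0 subr0 sub0r (bigD1 j) //= eqxx subr0 mulr1 big1 ?addr0 // => k kj.
  by rewrite (inj_eq Some_inj) eq_sym (negPf kj) subr0 mulr0.
by rewrite mulr1 sub0r big1 ?subr0 // => k _; rewrite mulr0.
Qed.

Definition energy u z : R :=
  'D_(coord_dir None) u z ^+ 2 + \sum_j 'D_(coord_dir (Some j)) u z ^+ 2.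

Lemma energy_ge0 u z : 0 <= energy u z.
Proof. by rewrite addr_ge0 ?sqr_ge0 // sumr_ge0 // => j _; exact: sqr_ge0. Qed.

Lemma continuous_energy u : C_k 2 u -> continuous (energy u).
Proof.
move=> Cu; have c i : continuous (fun z => 'D_(coord_dir i) u z ^+ 2).
  by apply: continuous_mul; exact: C2_continuous1.
by apply: continuous_add; [exact: c|apply: continuous_bigsum => j; exact: c].
Qed.

Lemma is_derive_energy u i z : C_k 2 u ->
  is_derive z (coord_dir i) (energy u)
   (2 * 'D_(coord_dir None) u z * 'D_(coord_dir i) ('D_(coord_dir None) u) z +
    \sum_j 2 * 'D_(coord_dir (Some j)) u z *
            'D_(coord_dir i) ('D_(coord_dir (Some j)) u) z).
Proof.
move=> Cu; apply: is_deriveD; first by apply: is_derive_sqr; exact: C2_deriv2.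
by apply: is_derive_bigsum => j; apply: is_derive_sqr; exact: C2_deriv2.
Qed.

Lemma derive_along_zero u i z : (forall h : R, u (h *: coord_dir i + z) = 0) ->
  'D_(coord_dir i) u z = 0.
Proof.
move=> h; apply: derive_val; apply: is_derive_line0.
by rewrite (_ : (fun s => _) = cst 0); [exact: is_derive_cst|exact/funext].
Qed.

End Energy.

(** * The weighted energy estimate and uniqueness for the Cauchy problem *)

Section EnergyEstimate.
Context {R : realType} {n : nat}.
Notation spacetime := (spacetime R n).
Implicit Types (z : spacetime) (i : option 'I_n) (u : spacetime -> R).
Implicit Types (A M S : R) (y : 'rV[R]_n).

Definition weight A M y z : R := pos_part (paraboloid A M y z).

Lemma is_derive_weight_sqr A M y i z :
  is_derive z (coord_dir i) (fun z => weight A M y z ^+ 2)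
    (2 * weight A M y z * dparaboloid M y i z).
Proof.
exact: (is_derive_comp1 (is_derive_paraboloid A M y i z)
                        (is_derive_pos_part_sqr _)).
Qed.

Lemma continuous_coordB (y : 'rV[R]_n) (j : 'I_n) :
  continuous (fun z => stcoord z (Some j) - y 0 j).
Proof.
by move=> z; apply: cvgB; [exact: continuous_coord|exact: cvg_cst].
Qed.

Lemma continuous_paraboloid A M y : continuous (paraboloid A M y).
Proof.
move=> z; apply: cvgB; last first.
  by apply: continuous_bigsum => j; apply: continuous_mul; exact: continuous_coordB.
apply: cvgB; first exact: cvg_cst.
by apply: cvgM; [exact: cvg_cst|exact: continuous_coord].
Qed.

Lemma continuous_dparaboloid M y i : continuous (dparaboloid M y i).
Proof.
case: i => [j|] z; last exact: cvg_cst.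
by apply: cvgN; apply: cvgM; [exact: cvg_cst|exact: continuous_coordB].
Qed.

Lemma continuous_weight A M y : continuous (weight A M y).
Proof.
move=> z; apply: (@continuous_comp _ _ _ (paraboloid A M y) (@pos_part R)).
  exact: continuous_paraboloid.
exact: continuous_pos_part.
Qed.

Lemma weight_ge0 A M y z : 0 <= weight A M y z.
Proof. by rewrite /weight /pos_part le_max lexx orbT. Qed.

Lemma weight_eq0 A M y z : paraboloid A M y z <= 0 -> weight A M y z = 0.
Proof. by move=> h; rewrite /weight /pos_part max_r. Qed.

(** Without the weight this is the energy current, which is divergence free for a wave. With it,
    only the terms in which the weight is differentiated survive. *)
Definition flux A M y u i z : R :=
  if i is Some j then
    - 2 * (weight A M y z ^+ 2 *
      ('D_(coord_dir None) u z * 'D_(coord_dir (Some j)) u z))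
  else weight A M y z ^+ 2 * energy u z.

Definition dflux A M y u i z : R :=
  if i is Some j then
    - 2 * (2 * weight A M y z * dparaboloid M y (Some j) z *
      ('D_(coord_dir None) u z * 'D_(coord_dir (Some j)) u z) +
      weight A M y z ^+ 2 *
      ('D_(coord_dir (Some j)) ('D_(coord_dir None) u) z
        * 'D_(coord_dir (Some j)) u z +
       'D_(coord_dir None) u z
        * 'D_(coord_dir (Some j)) ('D_(coord_dir (Some j)) u) z))
  else 2 * weight A M y z * dparaboloid M y None z * energy u z +
    weight A M y z ^+ 2 *
   (2 * 'D_(coord_dir None) u z * 'D_(coord_dir None) ('D_(coord_dir None) u) z +
    \sum_j 2 * 'D_(coord_dir (Some j)) u z *
            'D_(coord_dir None) ('D_(coord_dir (Some j)) u) z).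

Lemma is_derive_flux A M y u i z : C_k 2 u ->
  is_derive z (coord_dir i) (flux A M y u i) (dflux A M y u i z).
Proof.
move=> Cu; case: i => [j|].
  apply: is_derive_scale.
  apply: (is_derive_mul (is_derive_weight_sqr A M y (Some j) z)).
  exact: (is_derive_mul (C2_deriv2 None (Some j) z Cu)
                        (C2_deriv2 (Some j) (Some j) z Cu)).
exact: (is_derive_mul (is_derive_weight_sqr A M y None z)
                      (is_derive_energy None z Cu)).
Qed.

Lemma continuous_dflux A M y u i : C_k 2 u -> continuous (dflux A M y u i).
Proof.
move=> Cu.
have c2 : continuous (fun _ : spacetime => 2 : R) by move=> z; exact: cvg_cst.
have cw : continuous (fun z => weight A M y z ^+ 2).
  by apply: continuous_mul; exact: continuous_weight.
have cwd i' : continuous (fun z => 2 * weight A M y z * dparaboloid M y i' z).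
  apply: continuous_mul; last exact: continuous_dparaboloid.
  by apply: continuous_mul => //; exact: continuous_weight.
have c1 i' := @C2_continuous1 _ _ u i' Cu.
have cc i' i'' := @C2_continuous2 _ _ u i' i'' Cu.
case: i => [j|].
  apply: continuous_mul; first by move=> z; exact: cvg_cst.
  apply: continuous_add; first by apply: continuous_mul => //; exact: continuous_mul.
  by apply: continuous_mul => //; apply: continuous_add; exact: continuous_mul.
apply: continuous_add.
  by apply: continuous_mul => //; exact: continuous_energy.
apply: continuous_mul => //; apply: continuous_add.
  by apply: continuous_mul => //; exact: continuous_mul.
by apply: continuous_bigsum => j; apply: continuous_mul => //; exact: continuous_mul.
Qed.

(** Stated for arbitrary reals in place of derivatives, so that it is a plain identity of finite
    sums: the hypotheses cancel every term in w^2. *)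
Lemma sum_dflux_algebra (w M e dt dtt : R) (c d dtj djt djj : 'I_n -> R) :
  (forall j, dtj j = djt j) -> \sum_j djj j = dtt ->
  - (2 * w * - M * e + w ^+ 2 * (2 * dt * dtt + \sum_j 2 * d j * djt j) +
     \sum_j - 2 * (2 * w * - (2 * c j) * (dt * d j) +
                   w ^+ 2 * (dtj j * d j + dt * djj j))) =
  2 * w * (M * e - 4 * \sum_j c j * (dt * d j)).
Proof.
move=> swap <-.
rewrite [X in - (_ + X)](eq_bigr (fun j => 8 * w * (c j * (dt * d j)) -
  w ^+ 2 * (2 * d j * djt j + 2 * dt * djj j))); last first.
  by move=> j _; rewrite swap; ring.
by rewrite sumrB -!mulr_sumr big_split /= -mulr_sumr; ring.
Qed.

(* The second derivatives cancel by the wave equation and the symmetry of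
   mixed derivatives. *)
Lemma sum_dflux A M y u z : C_k 2 u ->
  laplacian u z = 'D_time_dir ('D_time_dir u) z ->
  - \sum_i dflux A M y u i z = 2 * weight A M y z *
    (M * energy u z - 4 * \sum_j (stcoord z (Some j) - y 0 j) *
       ('D_(coord_dir None) u z * 'D_(coord_dir (Some j)) u z)).
Proof.
move=> Cu wave; rewrite big_option.
exact: (@sum_dflux_algebra (weight A M y z) M (energy u z) _ _
  (fun j => stcoord z (Some j) - y 0 j) (fun j => 'D_(coord_dir (Some j)) u z)
  _ _ _ (fun j => C2_swap None (Some j) z Cu) wave).
Qed.

(** Each term is at most 2 S |b d_j|, hence at most S (b^2 + d_j^2). The sum over j counts b^2 with
    multiplicity n and each d_j^2 once; the factor n + 1 covers both. *)
Lemma sum_cross_le S (b : R) (c d : 'I_n -> R) :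
  0 <= S -> (forall j, `|c j| <= S / 2) ->
  4 * \sum_j c j * (b * d j) <= n.+1%:R * S * (b ^+ 2 + \sum_j d j ^+ 2).
Proof.
move=> S0 cS; rewrite mulr_sumr.
apply: (@le_trans _ _ (\sum_j (S * b ^+ 2 + S * d j ^+ 2))).
  apply: ler_sum => j _.
  have ab : 2 * `|b * d j| <= b ^+ 2 + d j ^+ 2.
    rewrite normrM -(real_normK (num_real (d j))) -(real_normK (num_real b)).
    by have := sqr_ge0 (`|b| - `|d j|); rewrite !expr2; lra.
  rewrite (le_trans (ler_norm _)) // normrM ger0_norm // normrM.
  rewrite -mulrDr; apply: (@le_trans _ _ (S * (2 * `|b * d j|))); last exact: ler_wpM2l.
  by have := ler_wpM2r (normr_ge0 (b * d j)) (cS j); lra.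
rewrite big_split /= sumr_const card_ord -mulr_natl -mulr_sumr.
have : 0 <= \sum_(j < n) d j ^+ 2 by apply: sumr_ge0 => j _; exact: sqr_ge0.
have := sqr_ge0 b.
move: (\sum_(j < n) _) (b ^+ 2) => a e e0 a0.
have := mulr_ge0 S0 a0; have := mulr_ge0 S0 e0 => Se Sa.
rewrite -natr1; have := mulr_ge0 (ler0n R n) Sa; lra.
Qed.

(** The cube has side [S], is centered at [y] in space and starts at time 0. The bound on [t] says M
    t < A, which makes the weight positive at [(y, t)]. *)
Lemma energy_eq0 S y u (t : R) : C_k 2 u ->
  (forall z, laplacian u z = 'D_time_dir ('D_time_dir u) z) ->
  (forall x, u (x, 0) = 0) -> (forall x, 'D_time_dir u (x, 0) = 0) ->
  0 < S -> 0 <= t < S -> (n.+1%:R * S + 1) * t < S ^+ 2 / 4 ->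
  1 <= S -> energy u (y, t) = 0.
Proof.
move=> Cu wave u0 du0 S0 /andP[t0 tS] tlt S1.
pose a (i : option 'I_n) := if i is Some j then y 0 j - S / 2 else 0.
(* [A] is the squared distance from [y] to the lateral faces, and [M] exceeds the constant of
   [sum_cross_le] by 1, leaving one copy of the energy. Both are kept opaque behind their
   equations. *)
have [A AE] : {A : R | A = S ^+ 2 / 4} by exists (S ^+ 2 / 4).
have [M ME] : {M : R | M = n.+1%:R * S + 1} by exists (n.+1%:R * S + 1).
have MS : S <= M.
  by rewrite ME -natr1; have := mulr_ge0 (ler0n R n) (ltW S0); lra.
have sum_ge0 z : 0 <= \sum_j (stcoord z (Some j) - y 0 j) ^+ 2.
  by rewrite sumr_ge0 // => j _; exact: sqr_ge0.
have weight_gt0 : 0 < weight A M y (y, t).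
  rewrite /weight /pos_part lt_max; apply/orP; left.
  rewrite /paraboloid big1 ?subr0 ?AE ?ME ?subr_gt0 // => j _.
  by rewrite /= subrr expr0n.
suff : 2 * weight A M y (y, t) * energy u (y, t) = 0.
  by move/eqP; rewrite mulf_eq0 mulf_eq0 pnatr_eq0 (gt_eqF weight_gt0) => /eqP.
apply: (@divergence_ge0_eq0 _ _ a S (flux A M y u) (dflux A M y u)
  (fun z => 2 * weight A M y z * energy u z) S0).
- by move=> i z; exact: is_derive_flux.
- by move=> i; exact: continuous_dflux.
- apply: continuous_mul; last exact: continuous_energy.
  apply: continuous_mul; first by move=> z; exact: cvg_cst.
  exact: continuous_weight.
- move=> i z Kz; have /andP[zt0 _] := Kz None; rewrite /= in zt0.
  have Mt0 : 0 <= M * z.2 by rewrite mulr_ge0 // (le_trans _ MS) // ltW.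
  (* On a lateral face one square in the paraboloid already equals [A], so the weight vanishes. *)
  case: i => [j|] /= face.
    rewrite weight_eq0; first by rewrite expr0n /= mul0r mulr0.
    rewrite /paraboloid /= (bigD1 j) //=.
    have : 0 <= \sum_(i | i != j) (z.1 0 i - y 0 i) ^+ 2.
      by rewrite sumr_ge0 // => k _; exact: sqr_ge0.
    have -> : (z.1 0 j - y 0 j) ^+ 2 = A.
      by rewrite AE !expr2; case: face => ->; field.
    by lra.
  (* On the bottom face the zero Cauchy data kill the energy; on the top face M S >= S^2 >= A kills
     the weight. *)
  case: face => zt.
    have -> : z = (z.1, 0) by move: zt; case: (z) => ? ? /= ->.
    suff -> : energy u (z.1, 0) = 0 by rewrite mulr0.
    rewrite /energy; have -> : 'D_(coord_dir None) u (z.1, 0) = 0 by exact: du0.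
    rewrite expr0n add0r big1 // => j _.
    rewrite derive_along_zero ?expr0n // => h.
    by rewrite (_ : _ + _ = (h *: delta_mx 0 j + z.1, 0)) ?u0 // -[RHS]/(_, _); congr pair;
      rewrite /= scaler0 addr0.
  rewrite weight_eq0; first by rewrite expr0n /= mul0r.
  rewrite /paraboloid /= zt add0r AE.
  have := sum_ge0 z; have : S * S <= M * S by rewrite ler_pM2r.
  by have := mulr_ge0 (ltW S0) (ltW S0); rewrite expr2 /=; lra.
- move=> z Kz; have w0 := weight_ge0 A M y z; have e0 := energy_ge0 u z.
  rewrite mulr_ge0 ?mulr_ge0 //= sum_dflux //.
  rewrite ler_wpM2l ?mulr_ge0 // lerBrDr ME [leRHS]mulrDl mul1r [leLHS]addrC lerD2r.
  apply: sum_cross_le => [|j]; first exact: ltW.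
  have /andP[] := Kz (Some j); rewrite /= => h1 h2.
  by rewrite ler_norml; apply/andP; split; lra.
- case=> [j|] /=; last by rewrite t0 add0r ltW.
  by apply/andP; split; lra.
- case=> [j|] /=; last by rewrite add0r.
  by lra.
Qed.

(** The energy vanishes at every time s >= 0 once the cube is large enough, so [u] has zero time
    derivative and keeps its initial value 0. *)
Lemma cauchy_zero_ge0 u y (t : R) : C_k 2 u ->
  (forall z, laplacian u z = 'D_time_dir ('D_time_dir u) z) ->
  (forall x, u (x, 0) = 0) -> (forall x, 'D_time_dir u (x, 0) = 0) ->
  0 <= t -> u (y, t) = 0.
Proof.
move=> Cu wave u0 du0 t0.
have dt0 s : 0 <= s -> 'D_time_dir u (y, s) = 0.
  (* With this [S], S^2 / 4 = (n + 2) (s + 1) S, which exceeds ((n + 1) S + 1) s because s <= s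
     S. *)
  move=> s0; pose S : R := 4 * (n.+2%:R * (s + 1)).
  have nge0 : 0 <= n%:R :> R by [].
  have E : n.+2%:R = n%:R + 2 :> R by rewrite -addn2 natrD.
  have S4 : 4 * (s + 1) <= S.
    rewrite /S ler_pM2l // ler_peMl ?E; lra.
  have SE : S ^+ 2 / 4 = (n%:R + 2) * (s + 1) * S by rewrite /S E; field.
  have : energy u (y, s) = 0.
    have [S0 S1 sS] : [/\ 0 < S, 1 <= S & s < S] by split; lra.
    apply: (@energy_eq0 S) => //; first by rewrite s0.
    rewrite SE -natr1.
    have := mulr_ge0 nge0 (ltW S0); have := mulr_ge0 s0 (ltW S0).
    have : s <= s * S by rewrite ler_peMr.
    by move: nge0 S0; clear; move: S n%:R => S m *; nra.
  move/eqP; rewrite paddr_eq0 ?sqr_ge0 ?sumr_ge0 //; last by move=> j _; exact: sqr_ge0.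
  by rewrite sqrf_eq0 => /andP[/eqP].
have [|x /andP[x0 _]] := @MVT_line _ _ u time_dir (y, 0) t t0.
  by move=> z; case: (C2_deriv None z Cu).
have line (s : R) : s *: time_dir + (y, 0) = (y, s) :> spacetime.
  by congr pair; rewrite /= ?scaler0 ?add0r // addr0 [_%:A]mulr1.
by rewrite !line u0 subr0 dt0 // mul0r.
Qed.

End EnergyEstimate.

(** * Linear combinations, time translations and time reflections of waves *)

Section WaveOperations.
Context {R : realType} {n : nat}.
Notation spacetime := (spacetime R n).
Implicit Types (z : spacetime) (i : option 'I_n) (u v : spacetime -> R).

Lemma C_k_continuous k u : C_k k u -> continuous u.
Proof. by case: k => [[]|k []]. Qed.

Lemma derive_scale_fun c i u : C_k 1 u ->
  'D_(coord_dir i) (fun z => c * u z) = (fun z => c * 'D_(coord_dir i) u z).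
Proof.
case=> _ /(_ i) [du _]; apply/funext => z; apply: derive_val.
by apply: is_derive_scale; exact: derivableP.
Qed.

Lemma derive_add_fun i u v : C_k 1 u -> C_k 1 v ->
  'D_(coord_dir i) (fun z => u z + v z) =
  (fun z => 'D_(coord_dir i) u z + 'D_(coord_dir i) v z).
Proof.
case=> _ /(_ i) [du _] [_ /(_ i) [dv _]]; apply/funext => z; apply: derive_val.
by apply: is_deriveD; exact: derivableP.
Qed.

Lemma C_kS1 k u : C_k k.+1 u -> C_k 1 u.
Proof.
by case=> cu h; split=> // i; have [? /C_k_continuous ?] := h i.
Qed.

Lemma C_k_scale k c u : C_k k u -> C_k k (fun z => c * u z).
Proof.
elim: k u => [|k IH] u Cu.
  by split=> //; apply: continuous_mul; [move=> z; exact: cvg_cst|case: Cu].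
have [cu h] := Cu; split=> [|i].
  by apply: continuous_mul => //; move=> z; exact: cvg_cst.
have [du Cdu] := h i; rewrite derive_scale_fun; last exact: C_kS1 Cu.
split; last exact: IH.
by move=> z; have [] := is_derive_scale c (derivableP (du z)).
Qed.

Lemma C_k_add k u v : C_k k u -> C_k k v -> C_k k (fun z => u z + v z).
Proof.
elim: k u v => [|k IH] u v Cu Cv.
  by split=> //; apply: continuous_add; [case: Cu|case: Cv].
have [cu hu] := Cu; have [cv hv] := Cv; split=> [|i]; first exact: continuous_add.
have [du Cdu] := hu i; have [dv Cdv] := hv i.
rewrite derive_add_fun; [|exact: C_kS1 Cu|exact: C_kS1 Cv].
split; last exact: IH.
by move=> z; exact: derivableD.
Qed.

(** The values s = 1 and s = -1 give translation by [b] and the reflection taking t to b - t,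
    treated together. *)
Definition time_affine (s b : R) z : spacetime := (z.1, s * z.2 + b).

Definition time_factor (s : R) i : R := if i is Some _ then 1 else s.

Lemma continuous_time_affine s b : continuous (time_affine s b).
Proof.
move=> z; apply: (@cvg_pair _ _ _ (nbhs z) (nbhs z.1) (nbhs (s * z.2 + b)) _ _ _
  fst (fun z => s * z.2 + b)); first exact: cvg_fst.
apply: cvgD; last exact: cvg_cst.
by apply: cvgM; [exact: cvg_cst|exact: cvg_snd].
Qed.

Lemma is_derive_time_affine s b i u z :
  derivable u (time_affine s b z) (coord_dir i) ->
  is_derive z (coord_dir i) (fun z => u (time_affine s b z))
    (time_factor s i * 'D_(coord_dir i) u (time_affine s b z)).
Proof.
move=> du; apply: (@is_derive_comp_affine _ _ _ u (time_affine s b) z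
  (coord_dir i) (time_factor s i *: coord_dir i)).
  move=> h; case: i {du} => [j|]; congr pair; rewrite /= ?scale1r ?scaler0 ?add0r //.
  by rewrite ![_%:A]mulr1 -[h *: s]/(h * s); ring.
by apply: is_derive_scale_dir; exact: derivableP.
Qed.

Lemma derive_time_affine s b i u : C_k 1 u ->
  'D_(coord_dir i) (fun z => u (time_affine s b z)) =
  (fun z => time_factor s i * 'D_(coord_dir i) u (time_affine s b z)).
Proof.
case=> _ /(_ i) [du _]; apply/funext => z; apply: derive_val.
exact: is_derive_time_affine.
Qed.

Lemma C_k_time_affine k s b u : C_k k u -> C_k k (fun z => u (time_affine s b z)).
Proof.
elim: k u => [|k IH] u Cu; have cu := C_k_continuous Cu.
  split=> // z; apply: (@continuous_comp _ _ _ (time_affine s b) u).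
    exact: continuous_time_affine.
  exact: cu.
have [_ h] := Cu; split=> [z|i].
  apply: (@continuous_comp _ _ _ (time_affine s b) u); last exact: cu.
  exact: continuous_time_affine.
have [du Cdu] := h i; rewrite derive_time_affine; last exact: C_kS1 Cu.
split; last exact: (C_k_scale _ (IH _ Cdu)).
by move=> z; have [] := is_derive_time_affine (du (time_affine s b z)).
Qed.

Lemma C_infty_derive i u : C_infty u -> C_infty ('D_(coord_dir i) u).
Proof. by move=> Cu k; have [_ /(_ i) []] := Cu k.+1. Qed.

(** The two sides are convertible; writing every direction as [coord_dir] lets the derivative rules
    treat space and time alike. *)
Lemma is_waveP u : is_wave u <-> C_infty u /\ forall z,
  \sum_j 'D_(coord_dir (Some j)) ('D_(coord_dir (Some j)) u) z =
  'D_(coord_dir None) ('D_(coord_dir None) u) z.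
Proof. by []. Qed.

Lemma is_wave_scale c u : is_wave u -> is_wave (fun z => c * u z).
Proof.
move=> /is_waveP[Cu wu]; apply/is_waveP; split=> [k|z]; first exact: C_k_scale.
have D i : 'D_(coord_dir i) ('D_(coord_dir i) (fun z => c * u z)) z =
    c * 'D_(coord_dir i) ('D_(coord_dir i) u) z.
  (* The inner derivative has to be rewritten as a function before the outer one is taken. *)
  have E := etrans (congr1 (fun f => 'D_(coord_dir i) f) (derive_scale_fun c i (Cu 1%N)))
    (derive_scale_fun c i (C_infty_derive i Cu 1%N)).
  exact: (congr1 (@^~ z) E).
apply: (etrans _ (esym (D None))); rewrite -wu mulr_sumr.
by apply: eq_bigr => j _; exact: D.
Qed.

Lemma is_wave_add u v : is_wave u -> is_wave v -> is_wave (fun z => u z + v z).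
Proof.
move=> /is_waveP[Cu wu] /is_waveP[Cv wv]; apply/is_waveP.
split=> [k|z]; first exact: C_k_add.
have D i : 'D_(coord_dir i) ('D_(coord_dir i) (fun z => u z + v z)) z =
    'D_(coord_dir i) ('D_(coord_dir i) u) z + 'D_(coord_dir i) ('D_(coord_dir i) v) z.
  have E := etrans
    (congr1 (fun f => 'D_(coord_dir i) f) (derive_add_fun i (Cu 1%N) (Cv 1%N)))
    (derive_add_fun i (C_infty_derive i Cu 1%N) (C_infty_derive i Cv 1%N)).
  exact: (congr1 (@^~ z) E).
apply: (etrans _ (esym (D None))); rewrite -wu -wv -big_split.
by apply: eq_bigr => j _; exact: D.
Qed.

Lemma is_wave_time_affine s b u : s ^+ 2 = 1 -> is_wave u ->
  is_wave (fun z => u (time_affine s b z)).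
Proof.
move=> s1 /is_waveP[Cu wu]; apply/is_waveP; split=> [k|z]; first exact: C_k_time_affine.
have D i : 'D_(coord_dir i) ('D_(coord_dir i) (fun z => u (time_affine s b z))) z =
    'D_(coord_dir i) ('D_(coord_dir i) u) (time_affine s b z).
  have C1 := C_infty_derive i Cu 1%N.
  have E := etrans
    (congr1 (fun f => 'D_(coord_dir i) f) (derive_time_affine s b i (Cu 1%N)))
    (derive_scale_fun (time_factor s i) i (C_k_time_affine s b C1)).
  have E1 := congr1 (@^~ z) (derive_time_affine s b i C1).
  apply: etrans (congr1 (@^~ z) E) _ => /=; apply: etrans (congr1 ( *%R _) E1) _.
  rewrite mulrA -expr2 (_ : time_factor s i ^+ 2 = 1) ?mul1r //.
  by case: (i) => [j|]; rewrite ?s1 ?expr1n.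
apply: (etrans _ (esym (D None))); rewrite -wu.
by apply: eq_bigr => j _; exact: D.
Qed.

(** The sum of u(x, b + t) and u(x, b - t) is a wave whose value at t = 0 is 2 u(x, b) = 0 and whose
    time derivatives cancel there; it has zero Cauchy data. *)
Lemma wave_odd u b : is_wave u -> (forall x, u (x, b) = 0) ->
  forall x t, u (x, b + t) = - u (x, b - t).
Proof.
move=> wu ub.
pose w z := u (time_affine 1 b z) + u (time_affine (- 1) b z).
have ww : is_wave w.
  by apply: is_wave_add; apply: is_wave_time_affine; rewrite ?sqrrN ?expr1n.
have C1 := (wu.1 1).
have w0 x : w (x, 0) = 0 by rewrite /w /time_affine /= !mulr0 !add0r ub addr0.
have dw0 x : 'D_time_dir w (x, 0) = 0.
  have E r := congr1 (@^~ (x, 0)) (derive_time_affine r b None C1).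
  apply: etrans (congr1 (@^~ (x, 0)) (derive_add_fun None
    (C_k_time_affine 1 b C1) (C_k_time_affine (- 1) b C1))) _.
  apply: etrans (congr2 +%R (E 1) (E (- 1))) _.
  by rewrite /time_affine /= !mulr0 mul1r mulN1r subrr.
have pos x t : 0 <= t -> u (x, b + t) = - u (x, b - t).
  move=> t0; have [C2 eq2] := ww.
  have /eqP := cauchy_zero_ge0 x (C2 2) eq2 w0 dw0 t0.
  rewrite /w /time_affine /= mul1r mulN1r addr_eq0 => /eqP.
  by rewrite addrC (addrC (- t)).
(* The relation is symmetric under t -> -t, so negative times reduce to positive ones. *)
move=> x t; have [|t0] := lerP 0 t; first exact: pos.
by apply/eqP; rewrite eq_sym eqr_oppLR -(opprK t) pos ?opprK // oppr_ge0 ltW.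
Qed.

End WaveOperations.

(** * Subgroups of the real line *)

Section Periods.
Context {R : realType}.

(** If no positive element lies below some e > 0, a positive element [p] less than [e] above the
    infimum of the positive elements is a generator: division by [p] leaves remainder 0. *)
Lemma subgroup_dense_or_cyclic (H : R -> Prop) (x0 : R) :
  0 < x0 -> H x0 -> (forall x y, H x -> H y -> H (x - y)) ->
  (forall e, 0 < e -> exists2 p, 0 < p < e & H p) \/
  (exists2 p, p != 0 & forall x, H x -> exists k : int, x = k%:~R * p).
Proof.
move=> x00 Hx0 HB.
have H0 : H 0 by rewrite -(subrr x0); exact: HB.
have HN x : H x -> H (- x) by move=> Hx; rewrite -sub0r; exact: HB.
have HD x y : H x -> H y -> H (x + y).
  by move=> Hx Hy; rewrite -(opprK y); apply: HB => //; exact: HN.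
have Hz (k : int) x : H x -> H (k%:~R * x).
  move=> Hx; have Hn (m : nat) : H (m%:R * x).
    by elim: m => [|m IH]; rewrite ?mul0r // -natr1 mulrDl mul1r; exact: HD.
  by case: k => m; rewrite ?NegzE ?mulrNz ?mulNr; [|apply: HN]; exact: Hn.
have [dense|/existsNP[e /not_implyP[e0 He]]] :=
  pselect (forall e, 0 < e -> exists2 p, 0 < p < e & H p); [by left|right].
pose P := [set p : R | 0 < p /\ H p].
have Plb : has_lbound P by exists 0 => x [/ltW].
have Pinf : has_inf P by split=> //; exists x0.
have [p [p0 Hp] pinf] := inf_adherent e0 Pinf.
exists p; first by rewrite gt_eqF.
move=> x Hx; exists (Num.floor (x / p)); apply/eqP; rewrite -subr_eq0.
set r := x - _; have Hr : H r by apply: HB => //; exact: Hz.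
have xE : x = x / p * p by rewrite divfK // gt_eqF.
have r0 : 0 <= r.
  by rewrite /r {1}xE -mulrBl mulr_ge0 ?(ltW p0) // subr_ge0 ge_floor.
have rp : r < p.
  rewrite /r {1}xE -mulrBl gtr_pMl // ltrBlDl.
  by have := lt_succ_floor (x / p); rewrite intrD addrC.
(* A nonzero remainder satisfies inf P <= r < p < inf P + e, so [p - r] would be a positive element
   below [e]. *)
apply: contrapT => /negP rn0; apply: He; exists (p - r); last exact: HB.
have rgt0 : 0 < r by rewrite lt_def rn0.
have infr : inf P <= r by apply: ge_inf.
by apply/andP; split; lra.
Qed.

End Periods.

(** * Vanishing times and time periods of a wave *)

Section ZeroSnapshots.
Context {R : realType} {n : nat}.
Notation spacetime := (spacetime R n).
Implicit Types (u : spacetime -> R) (t p : R).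

Definition zero_at u t := forall x, u (x, t) = 0.

Definition time_period u p := forall x t, u (x, t + p) = u (x, t).

Lemma time_periodB u p q : time_period u p -> time_period u q -> time_period u (p - q).
Proof. by move=> hp hq x t; rewrite addrA -[LHS]hq subrK hp. Qed.

Lemma time_periodN u p : time_period u p -> time_period u (- p).
Proof. by move=> hp x t; rewrite -[LHS]hp addrNK. Qed.

Lemma time_periodMz u p (k : int) : time_period u p -> time_period u (k%:~R * p).
Proof.
move=> hp; have hn (m : nat) : time_period u (m%:R * p).
  elim: m => [|m IH] x t; first by rewrite mul0r addr0.
  by rewrite -natr1 mulrDl mul1r addrA hp IH.
by case: k => m; rewrite ?NegzE ?mulrNz ?mulNr; [|apply: time_periodN]; exact: hn.
Qed.

(** The composition of the reflections about 0 and [b] is translation by 2 b, and their two sign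
    changes cancel. *)
Lemma wave_period u b : is_wave u -> zero_at u 0 -> zero_at u b ->
  time_period u (2 * b).
Proof.
move=> wu u0 ub x t.
have -> : t + 2 * b = b + (b + t) by ring.
rewrite (wave_odd wu ub) (_ : b - _ = 0 - t); last by ring.
by rewrite -(wave_odd wu u0) add0r.
Qed.

Lemma wave_continuous_time u x : is_wave u -> continuous (fun t => u (x, t)).
Proof.
move=> [/(_ 0%N) [cu _] _] t; apply: (@continuous_comp _ _ _ (fun t => (x, t)) u).
  by apply: (@cvg_pair _ _ _ (nbhs t) (nbhs x) (nbhs t) _ _ _ (fun=> x) id);
    [exact: cvg_cst|exact: cvg_id].
exact: cu.
Qed.

Lemma wave_zero_irrational u alpha : is_wave u -> irrational alpha ->
  zero_at u 0 -> zero_at u 1 -> zero_at u alpha -> forall z, u z = 0.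
Proof.
move=> wu irr u0 u1 ualpha [x t].
have P2 := wave_period wu u0 u1; have Pa := wave_period wu u0 ualpha.
have two0 : 0 < 2 * 1 :> R by [].
have [dense|[p p0 cyc]] := subgroup_dense_or_cyclic two0 P2 (@time_periodB u).
  apply/eqP; rewrite -normr_eq0 eq_le normr_ge0 andbT.
  apply/ler_addgt0Pr => e e0; rewrite add0r.
  have /cvgrPdist_lt /(_ e e0) := @wave_continuous_time u x wu 0.
  rewrite -filter_from_ballE => -[d /= d0 hd].
  have [p /andP[p0 pd] hp] := dense d d0.
  (* Reducing [t] modulo the small period [p] gives a time within [d] of 0, where |u| < e by
     continuity. *)
  pose k := Num.floor (t / p); pose r := t - k%:~R * p.
  have tE : t = t / p * p by rewrite divfK // gt_eqF.
  have r0 : 0 <= r.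
    by rewrite /r {1}tE -mulrBl mulr_ge0 ?(ltW p0) // subr_ge0 ge_floor.
  have rp : r < p.
    rewrite /r {1}tE -mulrBl gtr_pMl // ltrBlDl.
    by have := lt_succ_floor (t / p); rewrite intrD addrC.
  have -> : u (x, t) = u (x, r).
    by rewrite -(time_periodMz k hp x r) /r subrK.
  rewrite ltW //; have := hd r; rewrite u0 sub0r normrN; apply.
  by rewrite -ball_normE /ball_ /= sub0r normrN ger0_norm // (lt_trans rp).
(* If 2 = k p and 2 alpha = l p, then alpha = l / k. *)
exfalso; apply: irr.
have [k ek] := cyc _ P2; have [l el] := cyc _ Pa.
have k0 : k != 0.
  by apply: contraTneq two0 => k0; rewrite ek k0 mul0r ltxx.
have kR : k%:~R != 0 :> R by rewrite intr_eq0.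
have aE : alpha = l%:~R / k%:~R.
  apply: (mulIf kR); rewrite divfK //; apply: (mulIf p0).
  by rewrite -mulrA -ek -el; ring.
by exists (l%:~R / k%:~R) => //; rewrite fmorph_div /= !ratr_int aE.
Qed.

Lemma int_parity (m : int) : exists k : int, m = 2 * k \/ m = 2 * k + 1.
Proof.
exists (m %/ 2)%Z; have := divz_eq m 2.
have h1 := modz_ge0 m (isT : (2 : int) != 0).
have h2 := ltz_mod m (isT : (2 : int) != 0) => e.
have : (m %% 2)%Z = 0 \/ (m %% 2)%Z = 1 by lia.
by case=> r; rewrite r mulrC in e; [left; rewrite addr0 in e|right].
Qed.

Lemma wave_zero_rational u (p : int) (q : nat) (m : int) :
  is_wave u -> (0 < q)%N -> coprime `|p|%N q ->
  zero_at u 0 -> zero_at u 1 -> zero_at u (p%:~R / q%:R) ->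
  zero_at u (m%:~R / q%:R).
Proof.
move=> wu q0 cpq u0 u1 upq.
have qR : q%:R != 0 :> R by rewrite pnatr_eq0 -lt0n.
have P2 := wave_period wu u0 u1; have Pa := wave_period wu u0 upq.
have Pq : time_period u (2 / q%:R).
  (* A Bezout relation a p + b q = 1 expresses 2 / q through the periods 2 p / q and 2. *)
  have [[a b] /= ab] : exists ab : int * int, ab.1 * p + ab.2 * q%:Z = 1.
    by have /coprimezP := (cpq : coprimez p q).
  have -> : 2 / q%:R = a%:~R * (2 * (p%:~R / q%:R)) - (- b)%:~R * (2 * 1) :> R.
    have : (a * p + b * q%:Z)%:~R = 1 :> R by rewrite ab.
    rewrite intrD !intrM -pmulrn => abR.
    by rewrite intrN -[LHS]mulr1 -[X in _ * X = _]abR; field.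
  by apply: time_periodB; exact: time_periodMz.
have shift (k l : int) : zero_at u (l%:~R / q%:R) -> zero_at u ((2 * k + l)%:~R / q%:R).
  move=> ul x; rewrite -(ul x) -(time_periodMz k Pq x (l%:~R / q%:R)).
  by congr (u (x, _)); rewrite intrD intrM; field.
have zero_even (k : int) : zero_at u ((2 * k)%:~R / q%:R).
  by rewrite -[2 * k]addr0; apply: shift; rewrite mul0r.
(* The period 2 / q reaches the odd numerators from a single odd one: [p] if it is odd, else [q],
   whose time is 1. *)
have [r [l rl ur]] : exists r : int, exists2 l : int, r = 2 * l + 1 & zero_at u (r%:~R / q%:R).
  have [k [ep|op]] := int_parity p; last by exists p, k.
  have [l [eq|oq]] := int_parity q; last first.
    by exists q%:Z, l => //; rewrite -pmulrn divff.
  exfalso; move: cpq; have -> : q = (2 * `|l|)%N by lia.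
  have -> : `|p|%N = (2 * `|k|)%N by lia.
  by rewrite /coprime -muln_gcdr muln_eq1.
have [k [->|->]] := int_parity m; first exact: zero_even.
have -> : 2 * k + 1 = 2 * (k - l) + r by rewrite rl; ring.
exact: shift.
Qed.

End ZeroSnapshots.

(** * Standing waves and the zeros of the sine *)

Section StandingWave.
Context {R : realType} {n : nat}.
Notation spacetime := (spacetime R n).
Implicit Types (z : spacetime) (i : option 'I_n).

Definition trig (b : bool) : R -> R := if b then sin else cos.

Definition trig_sign (b : bool) : R := if b then 1 else -1.

Lemma is_derive_trig b (s : R) : is_derive s 1 (trig b) (trig_sign b * trig (~~ b) s).
Proof.
by case: b; rewrite /= ?mul1r ?mulN1r; [exact: is_derive_sin|exact: is_derive_cos].
Qed.

Lemma continuous_trig b : continuous (trig b).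
Proof. by case: b; [exact: continuous_sin|exact: continuous_cos]. Qed.

(** The booleans select sine or cosine in each factor. With the free amplitude [c] the family is
    closed under all coordinate derivatives, so smoothness follows by induction on the order. *)
Definition standing (k : 'I_n) (a c : R) (b1 b2 : bool) z : R :=
  c * (trig b1 (a * stcoord z None) * trig b2 (a * stcoord z (Some k))).

Lemma is_derive_standing k a c b1 b2 i z :
  is_derive z (coord_dir i) (standing k a c b1 b2)
   (if i is Some j then standing k a (c * (a * (j == k)%:R * trig_sign b2)) b1 (~~ b2) z
    else standing k a (c * (a * trig_sign b1)) (~~ b1) b2 z).
Proof.
have dtrig b i' : is_derive z (coord_dir i) (fun z => trig b (a * stcoord z i'))
    (trig_sign b * trig (~~ b) (a * stcoord z i') * (a * (i == i')%:R)).
  exact: (is_derive_comp1 (is_derive_scale a (is_derive_coord i i' z))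
                          (is_derive_trig b _)).
have := is_derive_scale c (is_derive_mul (dtrig b1 None) (dtrig b2 (Some k))).
move/is_derive_eq; apply; rewrite /standing; case: i {dtrig} => [j|] /=.
  by rewrite (inj_eq Some_inj); ring.
by ring.
Qed.

Lemma continuous_standing k a c b1 b2 : continuous (standing k a c b1 b2).
Proof.
have ctrig b i : continuous (fun z => trig b (a * stcoord z i)).
  move=> z; apply: (@continuous_comp _ _ _ (fun z => a * stcoord z i) (trig b)).
    by apply: cvgM; [exact: cvg_cst|exact: continuous_coord].
  exact: continuous_trig.
apply: continuous_mul; first by move=> z; exact: cvg_cst.
exact: continuous_mul.
Qed.

Lemma derive_standing k a c b1 b2 i : 'D_(coord_dir i) (standing k a c b1 b2) =
  if i is Some j then standing k a (c * (a * (j == k)%:R * trig_sign b2)) b1 (~~ b2)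
  else standing k a (c * (a * trig_sign b1)) (~~ b1) b2.
Proof.
apply/funext => z; rewrite (derive_val (is_derive := is_derive_standing k a c b1 b2 i z)).
by case: i.
Qed.

Lemma C_infty_standing k a c b1 b2 : C_infty (standing k a c b1 b2).
Proof.
move=> m; elim: m c b1 b2 => [|m IH] c b1 b2; split; try exact: continuous_standing.
  by [].
move=> i; split=> [z|]; first by case: (is_derive_standing k a c b1 b2 i z).
by rewrite derive_standing; case: i => [j|]; exact: IH.
Qed.

Lemma derive2_standing k a c b1 b2 i z :
  'D_(coord_dir i) ('D_(coord_dir i) (standing k a c b1 b2)) z =
  (if i is Some j then (j == k)%:R else 1) * standing k a (- (c * a ^+ 2)) b1 b2 z.
Proof.
have E := congr1 (fun f => 'D_(coord_dir i) f z) (derive_standing k a c b1 b2 i).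
apply: etrans E _; case: i => [j|].
  apply: etrans (congr1 (@^~ z) (derive_standing _ _ _ _ _ _)) _.
  rewrite /standing negbK; case: (j == k); last by rewrite !(mulr0, mul0r).
  by case: b2; rewrite /trig_sign /=; ring.
apply: etrans (congr1 (@^~ z) (derive_standing _ _ _ _ _ _)) _.
by rewrite /standing negbK; case: b1; rewrite /trig_sign /=; ring.
Qed.

Lemma is_wave_standing k a c b1 b2 : is_wave (standing k a c b1 b2).
Proof.
apply/is_waveP; split=> [|z]; first exact: C_infty_standing.
apply: etrans (eq_bigr _ (fun j _ => derive2_standing k a c b1 b2 (Some j) z)) _.
apply: etrans _ (esym (derive2_standing k a c b1 b2 None z)).
rewrite -mulr_suml; congr (_ * _).
by rewrite (bigD1 k) //= eqxx big1 ?addr0 // => j /negPf ->.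
Qed.

Lemma sin_intpi (k : int) : sin (k%:~R * pi) = 0 :> R.
Proof.
have hn (m : nat) : sin (m%:R * pi) = 0 :> R.
  elim: m => [|m IH]; first by rewrite mul0r sin0.
  by rewrite -natr1 mulrDl mul1r sinDpi IH oppr0.
by case: k => m; rewrite ?NegzE ?mulrNz ?mulNr ?sinN hn ?oppr0.
Qed.

(** Subtracting the integer part of [s] leaves a zero of the sine in [0, pi), and the sine is
    positive on (0, pi). *)
Lemma sin_mulpi_eq0 (s : R) : sin (s * pi) = 0 -> exists k : int, s = k%:~R.
Proof.
move=> s0; pose k := Num.floor s; exists k; pose r := s - k%:~R.
have r0 : 0 <= r by rewrite subr_ge0 ge_floor.
have r1 : r < 1.
  by rewrite ltrBlDl; have := lt_succ_floor s; rewrite intrD addrC.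
have sr : sin (r * pi) = 0.
  by rewrite mulrBl sinB s0 sin_intpi mul0r mulr0 subrr.
apply/eqP; rewrite -subr_eq0 -/r; apply: contraTT isT => rn0.
have : 0 < sin (r * pi).
  apply: sin_gt0_pi; have pi0 := pi_gt0 R.
  have rgt0 : 0 < r by rewrite lt_def rn0.
  by rewrite mulr_gt0 //= gtr_pMl.
by rewrite sr ltxx.
Qed.

End StandingWave.

(** * Reduction to differences of waves, and the theorem *)

Section Differences.
Context {R : realType} {n : nat}.
Implicit Types u v : spacetime R n -> R.

Lemma is_wave_sub u v : is_wave u -> is_wave v -> is_wave (fun z => u z + -1 * v z).
Proof. by move=> wu wv; exact: (is_wave_add wu (is_wave_scale _ wv)). Qed.

Lemma snapshot_zero_at u v t : snapshot u t = snapshot v t <->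
  zero_at (fun z => u z + -1 * v z) t.
Proof.
split=> [e x|h].
  by rewrite mulN1r -[u _]/(snapshot u t x) e subrr.
by apply/funext => x; apply/eqP; rewrite -subr_eq0 -mulN1r; apply/eqP; exact: h.
Qed.

End Differences.

Unset Implicit Arguments.

Theorem proposition3p1 (R : realType) (n : nat) (alpha : R) (n_ge1 : (1 <= n)%N) :
  (irrational alpha -> wave_determined n alpha) /\
  (forall (p : int) (q : nat),
     (0 < q)%N -> coprime `|p|%N q -> alpha = p%:~R / q%:R -> alpha != 0 ->
     forall t : R,
       snapshot_determined n alpha t <-> exists m : int, t = m%:~R * (1 / q%:R)).
Proof.
split=> [irr u v wu wv [/snapshot_zero_at e0 /snapshot_zero_at e1 /snapshot_zero_at ea]|].
  apply/funext => z; apply/eqP; rewrite -subr_eq0 -mulN1r; apply/eqP.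
  exact: (wave_zero_irrational (is_wave_sub wu wv) irr e0 e1 ea).
move=> p q q0 cpq -> _ t; split=> [det|[m ->] u v wu wv]; last first.
  move=> [/snapshot_zero_at e0 /snapshot_zero_at e1 /snapshot_zero_at ea].
  apply/snapshot_zero_at; rewrite mul1r.
  exact: (wave_zero_rational m (is_wave_sub wu wv) q0 cpq e0 e1 ea).
have qR : q%:R != 0 :> R by rewrite pnatr_eq0 -lt0n.
(* [n_ge1] provides a first space coordinate. The standing wave [w 1] is compared with [w 0], the
   zero wave. *)
pose k : 'I_n := Ordinal n_ge1; pose a : R := q%:R * pi.
pose w c : spacetime R n -> R := standing k a c true false.
have w0 x s : w 0 (x, s) = 0 by rewrite /w /standing mul0r.
have w1 s (l : int) : s * q%:R = l%:~R -> snapshot (w 1) s = snapshot (w 0) s.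
  move=> sl; apply/funext => x; rewrite /snapshot w0 /w /standing /= /a.
  by rewrite mulrAC (mulrC _ s) sl sin_intpi mul0r mulr0.
have same : same_snapshots (p%:~R / q%:R) (w 1) (w 0).
  split; [apply: (w1 _ 0)|apply: (w1 _ q%:Z)|apply: (w1 _ p)].
  - by rewrite mul0r.
  - by rewrite mul1r.
  - by rewrite divfK.
(* At x = 0 the cosine factor is 1, so equality of the snapshots gives sin(q pi t) = 0. *)
have := congr1 (@^~ 0) (det (w 1) (w 0) (is_wave_standing _ _ _ _ _)
  (is_wave_standing _ _ _ _ _) same).
rewrite /snapshot w0 /w /standing /= mxE mulr0 cos0 mulr1 mul1r /a mulrAC.
move=> /sin_mulpi_eq0 [m qt]; exists m.
by rewrite -qt mulrC mul1r mulKf.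
Qed.
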